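(* Let $n\ge 8$ or $n=3$, and let $M$ be a special real $n\times n$ matrix. Then $g_M(n)\ge 2(n-1)!$. Moreover, $g_M(n)=2(n-1)!$ if and only if $M\in\mathcal{M}_1(n)$ or $M\in\mathcal{M}_2(n)$.
   Context: A real $n\times n$ matrix $M=(m_{i,j})$ is special if $M$ is non-zero, $m_{i,1}=0$ for all $i$, $m_{1,j}=0$ for all $j$, and $\sum_{j=1}^n m_{i,j}=0$ for every $i\in\{1,\ldots,n\}$. Define $g_M(n)=|\{\pi\in Sym_n: \sum_{i=1}^n m_{i,\pi(i)}\ne 0\}|$. For $x\in\mathbb{R}\setminus\{0\}$ and $p_1\ne p_2$ in $\{2,\ldots,n\}$, the $(x,p_1,p_2)$-matrix is the $n\times n$ matrix with entries $x$ at positions $(i,p_1)$ for $i>1$, $-x$ at positions $(i,p_2)$ for $i>1$, and $0$ elsewhere; $\mathcal{M}_1(n)$ is the set of all such matrices. For $x\in\mathbb{R}\setminus\{0\}$ and $q_1,q_2,\tau\in\{2,\ldots,n\}$ with $q_1\ne q_2$, the $(x,q_1,q_2,\tau)$-matrix has entry $x$ at $(\tau,q_1)$, $-x$ at $(\tau,q_2)$ and $0$ elsewhere; $\mathcal{M}_2(n)$ is the set of all such matrices. *)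

(* Defs.v *)
From mathcomp Require Import all_boot all_order all_algebra all_fingroup.
From mathcomp Require Import reals.

Set Implicit Arguments.
Unset Strict Implicit.
Unset Printing Implicit Defensive.

Import Order.TTheory GRing.Theory Num.Theory.

Local Open Scope ring_scope.

(* Rows and columns are indexed by ['I_n], hence from 0: the mathematical index
   1 is the ordinal of value 0, and {2, ..., n} is the set of ordinals [i]
   with [(0 < i)%N]. *)

Definition special (R : realType) (n : nat) (M : 'M[R]_n) : Prop :=
  [/\ M <> 0,
      forall i j : 'I_n, nat_of_ord j = 0%N -> M i j = 0,
      forall i j : 'I_n, nat_of_ord i = 0%N -> M i j = 0
    & forall i : 'I_n, \sum_(j < n) M i j = 0].

Definition g (R : realType) (n : nat) (M : 'M[R]_n) : nat :=
  #|[set s : 'S_n | \sum_(i < n) M i (s i) != 0]|.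

Definition M1_mx (R : realType) (n : nat) (x : R) (p1 p2 : 'I_n) : 'M[R]_n :=
  \matrix_(i, j)
    if (0 < i)%N && (j == p1) then x
    else if (0 < i)%N && (j == p2) then - x
    else 0.

Definition in_M1 (R : realType) (n : nat) (M : 'M[R]_n) : Prop :=
  exists (x : R) (p1 p2 : 'I_n),
    [/\ x <> 0, (0 < p1)%N, (0 < p2)%N, p1 <> p2 & M = M1_mx x p1 p2].

Definition M2_mx (R : realType) (n : nat) (x : R) (q1 q2 t : 'I_n) : 'M[R]_n :=
  \matrix_(i, j)
    if (i == t) && (j == q1) then x
    else if (i == t) && (j == q2) then - x
    else 0.

Definition in_M2 (R : realType) (n : nat) (M : 'M[R]_n) : Prop :=
  exists (x : R) (q1 q2 t : 'I_n),
    [/\ x <> 0, [/\ (0 < q1)%N, (0 < q2)%N & (0 < t)%N], q1 <> q2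
      & M = M2_mx x q1 q2 t].

(* Main.v *)
(* Exchanging the images of two rows i, j in a permutation s changes the sum
   by d (s i) - d (s j), where d is the difference of the rows; when this is
   nonzero, s or its exchanged copy contributes to g M.  If there are two
   disjoint pairs of distinct rows, this applies with (i, j) to the s on which
   the first difference is discordant and with (k, l) to the remaining s on
   which the second one is.  A nonzero row difference has sum 0 and entry 0 in
   the first column, hence takes positive, negative and zero values, which
   makes both sets large enough: together more than 4 (n - 1)! when n >= 8.
   Otherwise all rows but one coincide (or n = 3 and the rows are distinct,
   where no sum vanishes), the sum at s is z (s t) for a vector z, and g M is
   (n - 1)! times the number of nonzero entries of z. *)
Require Import Defs.
From mathcomp Require Import all_boot all_order all_algebra all_fingroup.
From mathcomp Require Import reals.
From mathcomp Require Import zify ring.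

Set Implicit Arguments.
Unset Strict Implicit.
Unset Printing Implicit Defensive.

Import Order.TTheory GRing.Theory Num.Theory.

(** * Permutations with prescribed values *)

Lemma perm_extend (T : finType) (x y : seq T) :
  uniq x -> uniq y -> size x = size y -> exists s : {perm T}, map s x = y.
Proof.
elim: x y => [|a x IH] [|b y] //=; first by exists 1%g.
move=> /andP[ax ux] /andP[bY uy] [sxy].
have [s sE] := IH _ ux uy sxy.
(* The transposition corrects the image of [a] and moves no value already placed: these values
   differ from [s a] because [a] is not in [x], and from [b] because [b] is not in [y]. *)
exists (s * tperm (s a) b)%g; rewrite permM tpermL; congr (_ :: _).
rewrite -sE; apply/eq_in_map => c cx; rewrite permM tpermD //.
- by apply: contraNneq ax => /perm_inj ->.
- by apply: contraNneq bY => ->; rewrite -sE map_f.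
Qed.

(** Once one solution [t] is fixed, the solutions are the products [s * t] with [s] fixing every
    entry of [x], so they form a coset of a group of order [(n - size x)!]. *)
Lemma card_perm_prescribed n (x y : seq 'I_n) :
  uniq x -> uniq y -> size x = size y ->
  #|[set s : 'S_n | map s x == y]| = (n - size x)`!.
Proof.
move=> ux uy sxy; have [t tE] := perm_extend ux uy sxy.
have -> : [set s : 'S_n | map s x == y]
    = [set (s * t)%g | s in perm_on [set i | i \notin x]].
  apply/setP => s; rewrite inE; apply/eqP/imsetP => [sE|[u uP ->]].
    exists (s * t^-1)%g; last by rewrite mulgKV.
    apply/subsetP => i; rewrite !inE; apply: contraNN => ix.
    rewrite permM; apply/eqP/(@perm_inj _ t); rewrite permKV.
    by have /eq_in_map/(_ i ix) := etrans sE (esym tE).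
  rewrite -tE; apply/eq_in_map => i ix; rewrite permM (out_perm uP) //.
  by rewrite inE negbK.
rewrite card_imset; last exact: mulIg.
rewrite card_perm; congr _`!.
have -> : [set i | i \notin x] = ~: [set i in x].
  by apply/setP=> i; rewrite !inE.
by rewrite cardsCs setCK card_ord cardsE (card_uniqP ux).
Qed.

(** Double counting of the pairs of [s] and [t] with [map s x = h t]: since [h] is injective, each
    [s] matches at most one [t]. *)
Lemma card_perm_family n (T : finType) (h : T -> seq 'I_n) (A : {set T})
    (x : seq 'I_n) :
  injective h -> uniq x ->
  (forall t, t \in A -> uniq (h t) /\ size x = size (h t)) ->
  #|[set s : 'S_n | [exists t in A, map s x == h t]]|
  = (#|A| * (n - size x)`!)%N.
Proof.
move=> hI ux hA.
rewrite -sum1_card big_mkcond -sum_nat_const.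
have -> : \sum_(t in A) (n - size x)`! =
    \sum_(t in A) \sum_(s : 'S_n) (map s x == h t).
  apply: eq_bigr => t /hA[ut st].
  by rewrite -(card_perm_prescribed ux ut st) -sum1dep_card big_mkcond.
rewrite exchange_big /=; apply: eq_bigr => s _; rewrite inE.
case: ifP => [/exists_inP[t tA /eqP sE]|/negbT].
  rewrite (bigD1 t) //= sE eqxx big1 // => u /andP[_ ut].
  by apply/eqP; rewrite eqb0 (inj_eq hI) eq_sym.
rewrite negb_exists_in => /forall_inP H.
by rewrite big1 // => t /H /negbTE ->.
Qed.

(** * Exchanging the images of two rows *)

Definition rowdiff (R : zmodType) n (M : 'M[R]_n) (i j a : 'I_n) : R :=
  (M i a - M j a)%R.

Lemma sum_tperm (R : comRingType) n (M : 'M[R]_n) (i j : 'I_n) (s : 'S_n) :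
  i != j ->
  (\sum_k M k (s k) - \sum_k M k ((tperm i j * s)%g k)
    = rowdiff M i j (s i) - rowdiff M i j (s j))%R.
Proof.
move=> ij; rewrite -sumrB (bigD1 i) //= (bigD1 j) /=; last by rewrite eq_sym.
rewrite big1 => [|k /andP[ki kj]].
  by rewrite !permM tpermL tpermR /rowdiff; ring.
by rewrite permM tpermD ?subrr // eq_sym.
Qed.

(** The exchange always changes the sum on [A], so it maps the members of [A] with zero sum
    injectively to members with nonzero sum; at least half of [A] has nonzero sum. *)
Lemma card_swap_closed (R : comRingType) n (M : 'M[R]_n) (i j : 'I_n)
    (A : {set 'S_n}) : i != j ->
  (forall s, s \in A -> (tperm i j * s)%g \in A) ->
  (forall s, s \in A -> rowdiff M i j (s i) != rowdiff M i j (s j)) ->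
  (#|A| <= 2 * #|A :&: [set s : 'S_n | (\sum_k M k (s k) != 0)%R]|)%N.
Proof.
move=> ij Acl Ad; set N := [set s : 'S_n | _].
rewrite -(cardsID N A) mul2n -addnn leq_add2l.
rewrite -(card_imset (mem (A :\: N)) (mulgI (tperm i j))).
apply/subset_leq_card/subsetP.
move=> _ /imsetP[s + ->]; rewrite !inE negbK => /andP[/eqP s0 sA].
rewrite Acl //=; apply: contra (Ad s sA) => /eqP s'0.
by rewrite -subr_eq0 -sum_tperm // s0 s'0 subrr.
Qed.

(** * Pairs on which a function agrees or differs *)

Lemma card_differing (R : realDomainType) n (d : 'I_n -> R)
    (A : {set 'I_n}) (a b : 'I_n) :
  a \in A -> b \in A -> d a != d b ->
  (2 * #|A|.-1 <= #|[set p : 'I_n * 'I_n |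
      [&& p.1 \in A, p.2 \in A & d p.1 != d p.2]]|)%N.
Proof.
(* The level set [K] of [d a] and its complement in [A] are both nonempty, and a product of two
   positive integers is at least their sum minus 1. Pairs across the split are counted in both
   orders. *)
move=> aA bA dab; set K := [set c in A | d c == d a].
have aK : a \in K by rewrite inE aA eqxx.
have bK : b \in A :\: K by rewrite !inE bA andbT /= eq_sym.
have KA : K \subset A by apply/subsetP => c; rewrite inE => /andP[].
have cA : (#|A| = #|K| + #|A :\: K|)%N.
  by rewrite -(cardsID K A) (setIidPr KA).
have k0 : (0 < #|K|)%N by apply/card_gt0P; exists a.
have k1 : (0 < #|A :\: K|)%N by apply/card_gt0P; exists b.
have dj : setX K (A :\: K) :&: setX (A :\: K) K = set0.
  apply/setP => -[c e]; rewrite !inE /=.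
  by case: (c \in A); case: (e \in A); case: (d c == d a); case: (d e == d a).
have : #|setX K (A :\: K) :|: setX (A :\: K) K| =
    (2 * (#|K| * #|A :\: K|))%N.
  by rewrite cardsU dj cards0 !cardsX; lia.
move=> E.
apply: leq_trans (_ : #|setX K (A :\: K) :|: setX (A :\: K) K| <= _)%N.
  by rewrite E cA; nia.
apply/subset_leq_card/subsetP => -[c e]; rewrite !inE /=.
case/orP.
  by case/and3P=> /andP[-> /eqP ->] /[swap] -> /=; rewrite eq_sym.
by case/and3P=> /andP[/[swap] -> /=] + -> /eqP ->.
Qed.

Lemma sum0_exists_pos (R : realDomainType) (T : finType) (d : T -> R) (a : T) :
  (\sum_a d a = 0)%R -> d a != 0%R -> exists x, (0 < d x)%R.
Proof.
move=> dS da; apply/existsP.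
apply: contraNT da; rewrite negb_exists => /forallP H.
have : (\sum_a - d a = 0)%R by rewrite sumrN dS oppr0.
move/psumr_eq0P => E; rewrite -oppr_eq0; apply/eqP/E => // i _.
by rewrite oppr_ge0 leNgt.
Qed.

Lemma three_values (R : realDomainType) n (d : 'I_n -> R) (a : 'I_n) :
  (forall b : 'I_n, nat_of_ord b = 0%N -> d b = 0%R) -> (\sum_b d b = 0)%R ->
  d a != 0%R -> exists o x y, [/\ d o = 0, (0 < d x) & (d y < 0)]%R.
Proof.
move=> d0 dS da; have n0 : (0 < n)%N by have := ltn_ord a; lia.
have [x xP] := sum0_exists_pos dS da.
have [||y yP] := @sum0_exists_pos _ _ (fun a => - d a)%R a.
- by rewrite sumrN dS oppr0.
- by rewrite oppr_eq0.
exists (Ordinal n0), x, y; split => //; first exact: d0.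
by rewrite -oppr_gt0.
Qed.

(** Equal values have equal sign, and the positive, negative and zero classes are all nonempty. The
    sum of the squares of their sizes is largest when two of them are singletons. *)
Lemma card_equal_pairs (R : realDomainType) n (d : 'I_n -> R) (a : 'I_n) :
  (forall b : 'I_n, nat_of_ord b = 0%N -> d b = 0%R) -> (\sum_b d b = 0)%R ->
  d a != 0%R ->
  (#|[set p : 'I_n * 'I_n | d p.1 == d p.2]| <= (n - 2) ^ 2 + 2)%N.
Proof.
move=> d0 dS da; have [o [x [y [oP xP yP]]]] := three_values d0 dS da.
pose P := [set a | 0 < d a]%R; pose N := [set a | d a < 0]%R.
pose Z := [set a | d a == 0]%R.
have p1 : (0 < #|P|)%N by apply/card_gt0P; exists x; rewrite inE.
have n1 : (0 < #|N|)%N by apply/card_gt0P; exists y; rewrite inE.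
have z1 : (0 < #|Z|)%N by apply/card_gt0P; exists o; rewrite inE oP.
have tot : (#|P| + #|N| + #|Z| = n)%N.
  rewrite -[RHS]card_ord -(cardsC P) -addnA; congr (_ + _)%N.
  rewrite -(cardsID N (~: P)); congr (_ + _)%N; apply: eq_card => c.
    by rewrite !inE -leNgt andb_idl // => /ltW.
  by rewrite !inE -!leNgt [in RHS]andbC eq_le andbC.
apply: leq_trans (_ : #|setX P P :|: setX N N :|: setX Z Z| <= _)%N.
  apply/subset_leq_card/subsetP => -[c b]; rewrite !inE /= => /eqP ->.
  by case: (ltgtP (d b) 0%R) => // ->; rewrite eqxx !orbT.
apply: leq_trans (_ : #|P| ^ 2 + #|N| ^ 2 + #|Z| ^ 2 <= _)%N.
  by rewrite -!mulnn -!cardsX !cardsU; lia.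
move: p1 n1 z1 tot; move: #|P| #|N| #|Z| => [|p] [|q] [|z] // _ _ _ <-.
have -> : (p.+1 + q.+1 + z.+1 - 2 = p + q + z + 1)%N by lia.
rewrite -!mulnn; nia.
Qed.

(** * Two disjoint pairs of distinct rows *)

Lemma card_set_pairs (T1 T2 : finType) (B : {set T1 * T2}) :
  (#|B| = \sum_p #|[set q | (p, q) \in B]|)%N.
Proof.
rewrite -sum1_card; under [RHS]eq_bigr => p _ do rewrite -sum1dep_card.
by rewrite pair_big_dep; apply: eq_bigl => -[].
Qed.

(** The function [d2] takes three different values on [T], the set of [o], [x], [y]. If a concordant
    pair of distinct points [a], [b] is not contained in [T], two points of [T] avoid it, and
    [card_differing] applies to the [n - 2] points other than [a] and [b]. The diagonal and [T * T]
    cost at most [n + 9] pairs. *)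
Lemma card_concordant_discordant (R : realDomainType) n (d1 d2 : 'I_n -> R)
    (o x y : 'I_n) :
  d2 o = 0%R -> (0 < d2 x)%R -> (d2 y < 0)%R ->
  ((#|[set p : 'I_n * 'I_n | d1 p.1 == d1 p.2]| - n - 9) * (2 * (n - 3)) <=
  #|[set t : ('I_n * 'I_n) * ('I_n * 'I_n) |
      [&& uniq [:: t.1.1; t.1.2; t.2.1; t.2.2], d1 t.1.1 == d1 t.1.2
        & d2 t.2.1 != d2 t.2.2]]|)%N.
Proof.
move=> oP xP yP; set E := [set p | d1 p.1 == _]; set B := [set t | _].
have ox : d2 o != d2 x by rewrite oP lt_eqF.
have oy : d2 o != d2 y by rewrite oP gt_eqF.
have xy : d2 x != d2 y by rewrite gt_eqF // (lt_trans yP).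
pose T := [set o; x; y].
pose G := [set p in E | (p.1 != p.2) && (~~ ((p.1 \in T) && (p.2 \in T)))].
have cT : (#|T| <= 3)%N by rewrite !cardsU !cards1; lia.
have cG : (#|E| - n - 9 <= #|G|)%N.
  have : (#|E| <= #|G :|: [set (a, a) | a : 'I_n] :|: setX T T|)%N.
    apply/subset_leq_card/subsetP => -[a b] pE.
    rewrite [_ \in _ :|: _]inE [_ \in _ :|: [set _ | _ : _]]inE.
    rewrite [_ \in G]inE pE /=.
    case: eqVneq => [->|_] /=; first by rewrite imset_f ?orbT.
    by rewrite in_setX /=; case: (_ && _); rewrite ?orbT.
  have : (#|[set (a, a) | a : 'I_n]| <= n)%N.
    by rewrite -[leqRHS]card_ord leq_imset_card.
  have : (#|setX T T| <= 9)%N.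
    by rewrite cardsX; apply: leq_trans (leq_mul cT cT) _.
  by rewrite !cardsU; lia.
apply: leq_trans (leq_mul cG (leqnn _)) _.
rewrite -sum_nat_const (card_set_pairs B) [leqRHS](bigID (mem G)) /=.
apply: leq_trans (leq_addr _ _); apply: leq_sum => -[a b].
rewrite [_ \in G]inE [_ \in E]inE /= => /and3P[pE ab pT].
have [u [v [uA vA uv]]] : exists u v,
    [/\ u \in ~: [set a; b], v \in ~: [set a; b] & d2 u != d2 v].
  have avoid c : exists u v, [/\ u \in T :\ c, v \in T :\ c & d2 u != d2 v].
    have [<-|oc] := eqVneq o c.
      exists x, y; split=> //; rewrite !inE eqxx ?orbT andbT.
        by apply: contraNneq ox => ->.
      by apply: contraNneq oy => ->.
    have [<-|xc] := eqVneq x c.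
      exists o, y; split=> //; rewrite !inE eqxx ?orbT andbT.
        by apply: contraNneq ox => ->.
      by apply: contraNneq xy => ->.
    by exists o, x; split=> //; rewrite !inE eqxx ?orbT andbT.
  move: pT; rewrite negb_and => /orP[] /negP nT;
    [have [u [v []]] := avoid b | have [u [v []]] := avoid a].
    rewrite 2!in_setD1 => /andP[ub uT] /andP[vb vT] uv.
    exists u, v; split=> //; rewrite !inE negb_or ?ub ?vb andbT;
      by apply: contra_notN nT => /eqP <-.
  rewrite 2!in_setD1 => /andP[ub uT] /andP[vb vT] uv.
  exists u, v; split=> //; rewrite !inE negb_or ?ub ?vb /=;
    by apply: contra_notN nT => /eqP <-.
have cA : #|~: [set a; b]| = (n - 2)%N.
  by rewrite cardsCs setCK cards2 ab card_ord.
apply: leq_trans (_ : 2 * #|~: [set a; b]|.-1 <= _)%N.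
  by rewrite cA; lia.
apply: leq_trans (card_differing uA vA uv) _.
apply/subset_leq_card/subsetP => -[c e]; rewrite !inE /= pE !negb_or ab /=.
case/and3P => /andP[ca cb] /andP[ea eb] ce.
rewrite ce andbT /= (eq_sym a c) ca (eq_sym a e) ea (eq_sym b c) cb.
rewrite (eq_sym b e) eb /=.
by rewrite !andbT; apply: contraNneq ce => ->.
Qed.

(** Here [E] counts the value pairs on which the first row difference agrees, [F] is [(n - 4)!], and
    [P] and [Q] are the sizes of the two disjoint families of permutations, at least half of each
    having nonzero sum. *)
Lemma two_pairs_arith n E F P Q g : (8 <= n)%N ->
  (0 < F)%N -> (E <= (n - 2) ^ 2 + 2)%N ->
  ((n ^ 2 - E) * ((n - 2) * (n - 3) * F) <= P)%N ->
  ((E - n - 9) * (2 * (n - 3)) * F <= Q)%N ->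
  (P + Q <= 2 * g)%N -> (2 * ((n - 1) * ((n - 2) * (n - 3) * F)) < g)%N.
Proof.
move=> n8 F0 EU PL QL gU.
(* The goal doubled, with the common factor [(n - 3) * F] cancelled. *)
suff H : (4 * (n - 1) * (n - 2) < (n ^ 2 - E) * (n - 2) + 2 * (E - n - 9))%N.
  have F3 : (0 < (n - 3) * F)%N by rewrite muln_gt0 F0 andbT; lia.
  rewrite -(ltn_pmul2l (isT : 0 < 2)%N); apply: leq_trans gU.
  apply: leq_trans (leq_add PL QL).
  move: H; rewrite -(ltn_pmul2r F3) mulnDl.
  congr (_ < _)%N; last congr (_ + _)%N.
  - by rewrite -!mulnA [RHS]mulnA.
  - by rewrite -!mulnA.
  - by rewrite (mulnC 2) -!mulnA.
have [m nE] : exists m, n = m + 8 by exists (n - 8)%N; lia.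
move: EU; rewrite {}nE -!mulnn.
have -> : (m + 8 - 1 = m + 7)%N by lia.
have -> : (m + 8 - 2 = m + 6)%N by lia.
move=> EU.
(* The case [e = 0], where [E] is maximal, is the worst: each unit of [e] adds [m + 6] to the first
   term and takes at most 2 from the second. *)
have [e eE] : exists e, (m + 6) * (m + 6) + 2 = (E + e)%N.
  by exists ((m + 6) * (m + 6) + 2 - E)%N; rewrite subnKC.
have -> : ((m + 8) * (m + 8) - E = 4 * m + 26 + e)%N by lia.
rewrite mulnDl; have em : (6 * e <= e * (m + 6))%N.
  by rewrite mulnC leq_mul2l leq_addl orbT.
clear -eE em; lia.
Qed.

Lemma g_gt_of_two_pairs (R : realType) n (M : 'M[R]_n) (i j k l : 'I_n) :
  (8 <= n)%N -> special M -> uniq [:: i; j; k; l] ->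
  row i M != row j M -> row k M != row l M -> (2 * (n.-1)`! < g M)%N.
Proof.
move=> n8 [_ M0 _ MS] uq nij nkl.
have [ij kl] : i != j /\ k != l.
  by move: uq; rewrite /= !inE !negb_or => /and4P[/and3P[-> _ _] _ -> _].
have d0 r s (a : 'I_n) : nat_of_ord a = 0%N -> rowdiff M r s a = 0%R.
  by move=> a0; rewrite /rowdiff !M0 // subrr.
have dS r s : (\sum_a rowdiff M r s a = 0)%R by rewrite sumrB !MS subrr.
have dN r s : row r M != row s M -> exists a, rowdiff M r s a != 0%R.
  move=> rs; apply/existsP; apply: contraNT rs.
  rewrite negb_exists => /forallP H.
  apply/eqP/rowP => a; rewrite !mxE; apply/eqP; rewrite -subr_eq0.
  by move: (H a); rewrite negbK.
have [a1 a1P] := dN _ _ nij; have [a2 a2P] := dN _ _ nkl.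
set d1 := rowdiff M i j in a1P; set d2 := rowdiff M k l in a2P.
have EU : (#|[set p : 'I_n * 'I_n | d1 p.1 == d1 p.2]| <= (n - 2) ^ 2 + 2)%N.
  exact: (card_equal_pairs (d0 i j) (dS i j) a1P).
(* The first clause of [Q] keeps it disjoint from [P], so the nonzero sums found in each can be
   added. *)
pose P := [set s : 'S_n | d1 (s i) != d1 (s j)].
pose Q := [set s : 'S_n | (d1 (s i) == d1 (s j)) && (d2 (s k) != d2 (s l))].
(* Each discordant value pair at [i], [j] extends to [(n - 2)!] permutations; this factorial is
   expanded to share [(n - 4)!] with the bound for [Q], where four values are prescribed. *)
have PL : ((n ^ 2 - #|[set p : 'I_n * 'I_n | d1 p.1 == d1 p.2]|)
    * ((n - 2) * (n - 3) * (n - 4)`!) <= #|P|)%N.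
  pose h (p : 'I_n * 'I_n) := [:: p.1; p.2].
  have -> : (n ^ 2 - #|[set p : 'I_n * 'I_n | d1 p.1 == d1 p.2]| =
      #|~: [set p : 'I_n * 'I_n | d1 p.1 == d1 p.2]|)%N.
    by rewrite [RHS]cardsCs setCK card_prod card_ord mulnn.
  have H := @card_perm_family n _ h (~: [set p | d1 p.1 == d1 p.2]) [:: i; j].
  have -> : ((n - 2) * (n - 3) * (n - 4)`! = (n - 2)`!)%N.
    have [m ->] : exists m, n = m.+4 by exists (n - 4)%N; lia.
    by rewrite !subSS !subn0 -mulnA -!factS.
  rewrite -(H _ _ _) /= ?inE ?ij //.
  - apply/subset_leq_card/subsetP => s; rewrite !inE => /exists_inP[[a b]].
    by rewrite !inE /= => ab /eqP[-> ->].
  - by move=> [a b] [c e] [-> ->].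
  - move=> [a b]; rewrite !inE /= => ab; split=> //; rewrite andbT.
    by apply: contraNneq ab => ->.
have QL : ((#|[set p : 'I_n * 'I_n | d1 p.1 == d1 p.2]| - n - 9)
    * (2 * (n - 3)) * (n - 4)`! <= #|Q|)%N.
  have [o [x [y [oP xP yP]]]] := three_values (d0 k l) (dS k l) a2P.
  pose h (t : ('I_n * 'I_n) * ('I_n * 'I_n)) :=
    [:: t.1.1; t.1.2; t.2.1; t.2.2].
  pose B := [set t : ('I_n * 'I_n) * ('I_n * 'I_n) |
      [&& uniq (h t), d1 t.1.1 == d1 t.1.2 & d2 t.2.1 != d2 t.2.2]].
  have := @card_perm_family n _ h B [:: i; j; k; l].
  rewrite /= => H.
  have cQ := card_concordant_discordant d1 oP xP yP.
  apply: leq_trans (leq_mul cQ (leqnn _)) _.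
  rewrite -H //.
  - apply/subset_leq_card/subsetP => s; rewrite !inE.
    case/exists_inP => [[[a b] [c e]]].
    by rewrite !inE /= => /and3P[_ ab ce] /eqP[-> -> -> ->]; rewrite ab ce.
  - by move=> [[a b] [c e]] [[a' b'] [c' e']] [-> -> -> ->].
  - by move=> t; rewrite inE => /andP[ut _]; split.
pose N := [set s : 'S_n | (\sum_r M r (s r) != 0)%R].
have PU : (#|P| <= 2 * #|P :&: N|)%N.
  apply: card_swap_closed ij _ _ => s; rewrite !inE // !permM tpermL tpermR.
  by rewrite eq_sym.
(* Exchanging the images of [k] and [l] does not touch those of [i] and [j], so it preserves [Q]. *)
have QU : (#|Q| <= 2 * #|Q :&: N|)%N.
  apply: card_swap_closed kl _ _ => s; rewrite !inE; last by case/andP.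
  move: uq; rewrite /= !inE !negb_or.
  move=> /and4P[/and3P[_ ik il] /andP[jk jl] _ _].
  rewrite !permM tpermL tpermR !tpermD 1?eq_sym // => /andP[-> /=].
  by rewrite eq_sym.
have PQ : (#|P| + #|Q| <= 2 * g M)%N.
  apply: leq_trans (leq_add PU QU) _; rewrite -mulnDr leq_mul2l /=.
  have dj : P :&: N :&: (Q :&: N) = set0.
    by apply/setP => s; rewrite !inE; case: (d1 _ == d1 _); rewrite ?andbF.
  rewrite -[leqLHS]subn0 -(cards0 'S_n) -dj -cardsU.
  by apply/subset_leq_card; rewrite subUset !subsetIr.
have := two_pairs_arith n8 (fact_gt0 _) EU PL QL PQ.
have -> // : ((n - 1) * ((n - 2) * (n - 3) * (n - 4)`!) = n.-1`!)%N.
have [m ->] : exists m, n = m.+4 by exists (n - 4)%N; lia.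
by rewrite !subSS !subn0 -[in LHS]mulnA -!factS.
Qed.

(** * Coincidence of all rows but one *)

Lemma g_one_row (R : realType) n (M : 'M[R]_n) (t : 'I_n) (w z : 'I_n -> R) :
  (\sum_a w a = 0)%R ->
  (forall i a, M i a = w a + (if i == t then z a else 0))%R ->
  g M = (#|[set a | z a != 0%R]| * (n.-1)`!)%N.
Proof.
move=> w0 ME.
have fE (s : 'S_n) : (\sum_i M i (s i) = z (s t))%R.
  under eq_bigr => i _ do rewrite ME.
  (* A permutation meets every column once, so the common row [w] contributes its total, which is
     0. *)
  have ws : (\sum_i w (s i) = 0)%R.
    by move: w0; rewrite (reindex_inj (@perm_inj _ s)).
  rewrite big_split /= ws add0r.
  by rewrite -big_mkcond big_pred1_eq.
have := @card_perm_family n _ (fun a => [:: a]) [set a | z a != 0%R] [:: t].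
rewrite /= subn1 => <- //; last by move=> a b [].
apply: eq_card => s; rewrite !inE fE; apply/idP/exists_inP => [zs|[a]].
  by exists (s t); rewrite ?inE.
by rewrite inE => za /eqP[->].
Qed.

(** If the first alternative fails, any pair disjoint from a pair with different values has equal
    values. Given [r i != r j], all points other than [i] and [j] therefore share one value, and one
    of [i], [j] must share it too; the other serves as [t]. *)
Lemma rows_dichotomy (T : finType) (X : eqType) (r : T -> X) :
  (4 <= #|T|)%N ->
  (exists i j k l,
    [/\ uniq [:: i; j; k; l], r i != r j & r k != r l]) \/
  exists t, forall k l, k != t -> l != t -> r k = r l.
Proof.
move=> T4.
have [|/exists_inPn] := boolP
  [exists p : T * T * T * T, uniq [:: p.1.1.1; p.1.1.2; p.1.2; p.2] &&
     ((r p.1.1.1 != r p.1.1.2) && (r p.1.2 != r p.2))].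
  by case/existsP => -[[[i j] k] l] /and3P[/= u a b]; left; exists i, j, k, l.
move=> N; right.
have {}N i j k l : uniq [:: i; j; k; l] -> r i != r j -> r k = r l.
  move=> u rij; have := N (i, j, k, l) u; rewrite negb_and /= rij /= negbK.
  by move/eqP.
have pick (A : {set T}) : (#|A| <= 3)%N -> exists x, x \notin A.
  move=> A3; have : (0 < #|~: A|)%N by have := cardsC A; lia.
  by case/card_gt0P => x; rewrite inE; exists x.
have [k0 _] : exists k : T, k \notin set0 by apply: pick; rewrite cards0.
have [/existsP[[i j] /= rij]|/existsPn C] :=
  boolP [exists p : T * T, r p.1 != r p.2]; last first.
  by exists k0 => k l _ _; have /(_ (k, l)) := C; rewrite negbK => /eqP.
have ij : i != j by apply: contraNneq rij => ->.
have [k] : exists k, k \notin [set i; j] by apply: pick; rewrite cards2; lia.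
rewrite !inE negb_or => /andP[ki kj].
have [l] : exists l, l \notin k |: [set i; j].
  by apply: pick; rewrite cardsU1 cards2; lia.
rewrite !inE !negb_or => /and3P[lk li lj].
have out x : x != i -> x != j -> r x = r k.
  move=> xi xj; have [->//|xk] := eqVneq x k.
  apply: (N i j) => //; rewrite /= !inE !negb_or ij (eq_sym i) xi (eq_sym i) ki.
  by rewrite (eq_sym j) xj (eq_sym j) kj xk.
suff [rk|rk] : r i = r k \/ r j = r k.
- exists j => x y xj yj; transitivity (r k); last symmetry.
    by have [->|xi] := eqVneq x i; [|apply: out].
  by have [->|yi] := eqVneq y i; [|apply: out].
- exists i => x y xi yi; transitivity (r k); last symmetry.
    by have [->|xj] := eqVneq x j; [|apply: out].
  by have [->|yj] := eqVneq y j; [|apply: out].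
(* If [r i] differs from [r k], the disjoint pair [j], [l] has equal values, and [r l = r k]. *)
have [->|rik] := eqVneq (r i) (r k); [by left|right].
rewrite -(out l) //; apply: (N i k) => //.
rewrite /= !inE !negb_or (eq_sym i) ki ij (eq_sym i) li kj.
by rewrite (eq_sym k) lk (eq_sym j) lj.
Qed.

(** * Dipoles, the nonzero rows of the extremal matrices *)

Definition dipole (R : nmodType) (T : eqType) (x y : R) (p q a : T) : R :=
  if a == p then x else if a == q then y else 0%R.

Lemma card_dipole (R : nmodType) (T : finType) (x y : R) (p q : T) :
  x != 0%R -> y != 0%R -> p != q -> #|[set a | dipole x y p q a != 0%R]| = 2.
Proof.
move=> x0 y0 pq; suff -> : [set a | dipole x y p q a != 0%R] = [set p; q].
  by rewrite cards2 pq.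
apply/setP => a; rewrite !inE /dipole.
by case: (a == p) => //; case: (a == q); rewrite ?eqxx.
Qed.

Lemma sum_dipole (R : zmodType) (T : finType) (x : R) (p q : T) :
  p != q -> (\sum_a dipole x (- x) p q a = 0)%R.
Proof.
move=> pq; rewrite (bigD1 p) //= (bigD1 q) /=; last by rewrite eq_sym.
rewrite big1 => [|a /andP[ap aq]].
  by rewrite /dipole eqxx eq_sym (negbTE pq) eqxx addr0 subrr.
by rewrite /dipole (negbTE ap) (negbTE aq).
Qed.

Lemma sum0_dipole (R : zmodType) (T : finType) (z : T -> R) :
  (\sum_a z a = 0)%R -> #|[set a | z a != 0%R]| = 2 ->
  exists p q,
    [/\ p != q, z p != 0%R, z q != 0%R & z =1 dipole (z p) (- z p)%R p q].
Proof.
move=> zS /eqP/cards2P[p [q [pq zE]]]; exists p, q.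
have z0 a : (z a != 0%R) = (a == p) || (a == q).
  by have /setP/(_ a) := zE; rewrite !inE.
have zq : z q = (- z p)%R.
  move: zS; rewrite (bigD1 p) //= (bigD1 q) /=; last by rewrite eq_sym.
  rewrite big1 ?addr0 => [|a /andP[ap aq]].
    by move/eqP; rewrite addrC addr_eq0 => /eqP.
  by apply/eqP; rewrite -[_ == _]negbK z0 negb_or ap aq.
split; rewrite ?z0 ?eqxx ?orbT // => a; rewrite /dipole.
have := z0 a; case: (eqVneq a p) => [->//|ap]; case: (eqVneq a q) => [->//|aq].
by move=> /= /negbFE /eqP.
Qed.

(** * Extremal matrices and the equality case *)

Lemma g_in_M1 (R : realType) n (M : 'M[R]_n) :
  in_M1 M -> g M = (2 * (n.-1)`!)%N.
Proof.
case=> x [p [q [/eqP x0 p0 q0 /eqP pq ->]]].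
have n0 : (0 < n)%N by have := ltn_ord p; lia.
(* The exceptional row is the first one. It is zero while the others equal a dipole, so its
   deviation is the opposite dipole. *)
rewrite (@g_one_row _ _ _ (Ordinal n0) (dipole x (- x)%R p q)
  (dipole (- x)%R x p q)).
- by rewrite card_dipole ?oppr_eq0.
- exact: sum_dipole.
move=> i a; rewrite mxE /dipole -[i == _]/(nat_of_ord i == 0)%N lt0n.
by case: (_ == 0)%N => /=; case: (a == p); case: (a == q);
  rewrite /= ?addr0 ?subrr ?addNr.
Qed.

Lemma g_in_M2 (R : realType) n (M : 'M[R]_n) :
  in_M2 M -> g M = (2 * (n.-1)`!)%N.
Proof.
case=> x [p [q [t [/eqP x0 _ /eqP pq ->]]]].
(* Here the common row is zero and row [t] is the dipole. *)
rewrite (@g_one_row _ _ _ t (fun=> 0%R) (dipole x (- x)%R p q)).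
- by rewrite card_dipole ?oppr_eq0.
- by rewrite big1.
by move=> i a; rewrite mxE /dipole add0r; case: (i == t).
Qed.

(** The deviation [z] of row [t] from the common row is nonzero with sum 0, so it has at least two
    nonzero entries; exactly two make it a dipole. The zero first row then decides the family: if it
    is row [t], the common row is [- z], giving [in_M1]; otherwise the common row is zero, giving
    [in_M2]. *)
Lemma g_equal_rows (R : realType) n (M : 'M[R]_n) (t : 'I_n) :
  (2 <= n)%N -> special M ->
  (forall k l, k != t -> l != t -> row k M = row l M) ->
  (2 * (n.-1)`! <= g M)%N /\ (g M = (2 * (n.-1)`!)%N -> in_M1 M \/ in_M2 M).
Proof.
move=> n2 [Mn0 M0 M0r MS] rE.
have [k kt] : exists k, k != t.
  apply/existsP; rewrite -[[exists _, _]]negbK negb_exists; apply/forallP => H.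
  have : (#|[set: 'I_n]| <= #|[set t]|)%N.
    by apply/subset_leq_card/subsetP => i _; rewrite inE -[_ == _]negbK.
  by rewrite cardsT card_ord cards1; lia.
pose z a := (M t a - M k a)%R.
have ME i a : M i a = (M k a + (if i == t then z a else 0))%R.
  case: eqVneq => [->|it]; first by rewrite /z addrC subrK.
  by rewrite addr0; have /rowP/(_ a) := rE i k it kt; rewrite !mxE.
have zS : (\sum_a z a = 0)%R by rewrite sumrB !MS subrr.
have n0 : (0 < n)%N by lia.
pose o := Ordinal n0.
have oP a : M o a = 0%R by rewrite M0r.
have [a za] : exists a, z a != 0%R.
  (* If [z] vanished, every row would equal the first one, which is zero. *)
  apply/existsP; apply: contra_notT Mn0; rewrite negb_exists => /forallP z0.
  have {}z0 a : z a = 0%R by apply/eqP; rewrite -[_ == _]negbK.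
  apply/matrixP => i a; rewrite mxE -[RHS](oP a) (ME i) (ME o) z0.
  by rewrite !if_same.
have gE := g_one_row (MS k) ME.
have z0 b : nat_of_ord b = 0%N -> z b = 0%R.
  by move=> b0; rewrite /z !M0 // subrr.
have [_ [x [y [_ xP yP]]]] := three_values z0 zS za.
have z2 : (2 <= #|[set a | z a != 0%R]|)%N.
  have -> : 2 = #|[set x; y]|.
    rewrite cards2; case: eqVneq => // xy.
    by move: (lt_trans yP xP); rewrite xy ltxx.
  apply/subset_leq_card/subsetP => b; rewrite !inE => /orP[] /eqP ->.
    by rewrite gt_eqF.
  by rewrite lt_eqF.
split; first by rewrite gE leq_mul2r z2 orbT.
rewrite gE => /eqP; rewrite eqn_pmul2r ?fact_gt0 // => /eqP zc.
have [p [q [pq zp zq zE]]] := sum0_dipole zS zc.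
have pos b : z b != 0%R -> (0 < b)%N.
  by rewrite lt0n; apply: contra => /eqP/z0 ->.
have [ot|ot] := eqVneq o t.
  left; exists (- z p)%R, p, q; split; rewrite ?pos //; try exact/eqP.
    by apply/eqP; rewrite oppr_eq0.
  have kE b : M k b = (- z b)%R by rewrite /z -ot oP sub0r opprK.
  apply/matrixP => i b; rewrite ME mxE kE -ot -[i == o]/(nat_of_ord i == 0)%N.
  rewrite lt0n zE /dipole; case: (nat_of_ord i == 0)%N; rewrite /= ?addNr //.
  by rewrite addr0; case: (b == p) => //; case: (b == q); rewrite ?oppr0.
right; exists (z p), p, q, t; split; try exact/eqP.
  split; [exact: pos|exact: pos|rewrite lt0n; apply: contra ot => t0].
  by rewrite eq_sym -[t == o]/(nat_of_ord t == 0)%N.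
have kE b : M k b = 0%R.
  by have /rowP/(_ b) := rE k o kt ot; rewrite !mxE => ->.
apply/matrixP => i b; rewrite ME mxE kE add0r zE /dipole.
by case: (i == t).
Qed.

(** * Three distinct rows *)

Lemma g_distinct_rows3 (R : realType) (M : 'M[R]_3) :
  special M -> (forall i j, i != j -> row i M != row j M) -> g M = 6.
Proof.
move=> [_ M0 _ MS] rD.
suff -> : g M = #|[set: 'S_3]| by rewrite cardsT card_Sn.
apply: eq_card => s; rewrite !inE.
pose c1 : 'I_3 := lift ord0 ord0; pose c2 : 'I_3 := lift ord0 (lift ord0 ord0).
(* A row is determined by its entry in [c1], so distinct rows differ there. *)
have rE i : (M i c2 = - M i c1)%R.
  apply/eqP; rewrite -addr_eq0 addrC; have := MS i.
  by rewrite !big_ord_recl big_ord0 M0 // add0r addr0 => ->.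
(* Summing over columns turns the sum into the difference of the [c1] entries of two distinct
   rows. *)
rewrite (reindex_inj (@perm_inj _ s^-1)%g) /=.
under eq_bigr => c _ do rewrite permKV.
rewrite !big_ord_recl big_ord0 M0 // add0r addr0 -/c1 -/c2 rE subr_eq0.
have : (s^-1 c1)%g != (s^-1 c2)%g by rewrite (inj_eq perm_inj).
move/rD; apply: contra => /eqP E.
apply/eqP/rowP => -[[|[|[|//]]] lt]; rewrite !mxE; first by rewrite !M0.
  by rewrite (_ : Ordinal lt = c1) //; apply: val_inj.
by rewrite (_ : Ordinal lt = c2) ?rE ?E //; apply: val_inj.
Qed.

(** * Combination of the cases *)

Theorem theorem1 (R : realType) (n : nat) (M : 'M[R]_n)
    (hn : (8 <= n)%N \/ n = 3) (hM : special M) :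
  (2 * (n.-1)`! <= g M)%N /\
  (g M = (2 * (n.-1)`!)%N <-> in_M1 M \/ in_M2 M).
Proof.
have conv : in_M1 M \/ in_M2 M -> g M = (2 * (n.-1)`!)%N.
  by case; [exact: g_in_M1|exact: g_in_M2].
have strict : (2 * (n.-1)`! < g M)%N ->
    (2 * (n.-1)`! <= g M)%N /\
    (g M = (2 * (n.-1)`!)%N <-> in_M1 M \/ in_M2 M).
  move=> lt; split; first exact: ltnW.
  by split=> [E|//]; rewrite E ltnn in lt.
suff [/strict//|[t rE]] : (2 * (n.-1)`! < g M)%N \/
    exists t, forall k l, k != t -> l != t -> row k M = row l M.
  have [|le eq] := @g_equal_rows _ _ _ t _ hM rE; first by case: hn; lia.
  by split.
case: hn => [n8|n3].
  have [|[i [j [k [l [u rij rkl]]]]]|] :=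
    @rows_dichotomy _ _ (fun i => row i M).
  - by rewrite card_ord; lia.
  - by left; apply: g_gt_of_two_pairs rij rkl.
  - by right.
subst n.
have [/existsP[[i j] /= /andP[ij /eqP rij]]|/existsPn D] :=
  boolP [exists p, (p.1 != p.2) && (row p.1 M == row p.2 M)].
  (* With three rows, two of them equal, the remaining one is the exceptional row [t]. *)
  have ijC : #|~: [set i; j]| = 1 by rewrite cardsCs setCK cards2 ij card_ord.
  have /eqP/cards1P[t tE] := ijC.
  right; exists t.
  have ktP k : k != t -> row k M = row i M.
    rewrite -in_set1 -tE !inE negbK => /orP[] /eqP -> //.
  by move=> k l /ktP -> /ktP ->.
(* The value 6 exceeds [2 * 2!], which is 4. *)
left; rewrite g_distinct_rows3 // => i j ij.
by have := D (i, j); rewrite /= ij.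
Qed.
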